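(* Let $k$ be a nonnegative integer and let $\alpha=(\alpha_1,\dots,\alpha_n)$ be an integral $K$-basis of $L$. Then the following hold. (1) $\mathfrak m_L^k[G]$ is the kernel of the map $\mathcal O_L[G]\to \mathrm{Res}(L,k)[G]$, $\sum_{g\in G}a_g g\mapsto \sum_{g\in G}\pi_L^{(k)}(a_g)g$. (2) $\mathrm{End}_K^k(L)$ is the kernel of the map $\mathrm{End}_K^0(L)\to \mathrm{End}_{\mathrm{Res}(K,k)}(\mathrm{Res}(L,k))$, $f\mapsto \overline f_k$. (3) $\psi_\alpha(\mathrm{End}_K^k(L))=\mathrm{Mat}_n(\mathfrak m_K^k)$. (4) Consider the diagram with three rows $$0\to \mathfrak m_L^k[G]\to \mathcal O_L[G]\to \mathrm{Res}(L,k)[G]\to 0,$$ $$0\to \mathrm{End}_K^k(L)\to \mathrm{End}_K^0(L)\to \mathrm{End}_{\mathrm{Res}(K,k)}(\mathrm{Res}(L,k))\to 0,$$ $$0\to \mathrm{Mat}_n(\mathfrak m_K^k)\to \mathrm{Mat}_n(\mathcal O_K)\to \mathrm{Mat}_n(\mathrm{Res}(K,k))\to 0,$$ where the first nonzero map in each row is the inclusion, the second maps of the first two rows are those of (1) and (2), and the second map of the third row is entrywise reduction; the vertical maps from the first row to the second are (from left to right) $\varphi_k,\varphi_0,\overline\varphi_k$, and the vertical maps from the second row to the third are $\psi_\alpha,\psi_\alpha,\psi_{\overline\alpha}$ (the first two suitably restricted). Then this diagram is commutative, all rows are exact, and all the vertical maps are isomorphisms.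
   Context: $K$ is a local field: it is complete with respect to a discrete valuation $\mathrm{val}_K$ (normalised so that a fixed uniformizer $\pi$ has $\mathrm{val}_K(\pi)=1$) and has finite residue field. $L/K$ is an unramified Galois extension of finite degree $n$ with (cyclic) Galois group $G$; $\mathrm{val}_L$ is the unique extension of $\mathrm{val}_K$ to $L$. $\mathcal O_K,\mathcal O_L$ are the valuation rings and $\mathfrak m_K=\pi\mathcal O_K$, $\mathfrak m_L=\pi\mathcal O_L$ their maximal ideals. For $k\ge 0$, $\mathrm{Res}(K,k)=\mathcal O_K/\mathfrak m_K^k$, $\mathrm{Res}(L,k)=\mathcal O_L/\mathfrak m_L^k$, and $\pi_L^{(k)}:\mathcal O_L\to\mathrm{Res}(L,k)$ is the canonical projection. $G$ acts on $\mathcal O_L$, $\mathfrak m_L^k$ and $\mathrm{Res}(L,k)$. For a commutative ring $S$ with an action of $G$, the skew group algebra $S[G]$ is the free $S$-module with basis $G$ and multiplication $(ag)(bh)=a\,g(b)\,gh$ for $a,b\in S$, $g,h\in G$; $\mathfrak m_L^k[G]=\{\sum_g a_g g\in L[G]: a_g\in\mathfrak m_L^k\}$. The map $\varphi:L[G]\to\mathrm{End}_K(L)$, $\sum_g a_g g\mapsto (x\mapsto\sum_g a_g g(x))$, is an isomorphism of $K$-algebras. $\mathrm{End}_K^k(L)=\{f\in\mathrm{End}_K(L): f(\mathcal O_L)\subseteq\mathfrak m_L^k\}$. $\varphi_k$ is the restriction of $\varphi$ to $\mathfrak m_L^k[G]$ (so $\varphi_0$ is its restriction to $\mathcal O_L[G]$),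 regarded as a map to $\mathrm{End}_K^k(L)$. $\overline\varphi_k:\mathrm{Res}(L,k)[G]\to\mathrm{End}_{\mathrm{Res}(K,k)}(\mathrm{Res}(L,k))$ is the map induced by $\varphi$, i.e. $\sum_g a_g g\mapsto(x\mapsto \sum_g a_g g(x))$. For $f\in\mathrm{End}_K^0(L)$, $\overline f_k$ denotes the endomorphism of $\mathrm{Res}(L,k)$ induced by $f|_{\mathcal O_L}$. An integral $K$-basis of $L$ is a $K$-basis $\alpha=(\alpha_1,\dots,\alpha_n)$ of $L$ with $\mathrm{val}_L(\alpha_i)\ge 0$ for all $i$ that is an $\mathcal O_K$-basis of $\mathcal O_L$. $\psi_\alpha$ sends a $K$-endomorphism of $L$ to its matrix with respect to $\alpha$, and $\psi_{\overline\alpha}$ sends a $\mathrm{Res}(K,k)$-endomorphism of $\mathrm{Res}(L,k)$ to its matrix with respect to the image $\overline\alpha$ of $\alpha$ in $\mathrm{Res}(L,k)$. *)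

(* Defs.v *)
From HB Require Import structures.
From mathcomp Require Import all_boot all_order all_algebra all_fingroup all_field.
From mathcomp Require Import generic_quotient ring_quotient.
From mathcomp Require Import boolp classical_sets functions cardinality.

Set Implicit Arguments.
Unset Strict Implicit.
Unset Printing Implicit Defensive.

Import Order.TTheory GRing.Theory Num.Theory.
Local Open Scope ring_scope.
Local Open Scope quotient_scope.

(* The value at 0, which should be +oo, is left unspecified; bounds on
   valuations of possibly zero elements go through [vge], for which 0 is above
   every bound. *)
Record valuation (F : fieldType) (T : realDomainType) := Valuation {
  val_fun :> F -> T;
  valuationM : forall x y, x != 0 -> y != 0 ->
    val_fun (x * y) = val_fun x + val_fun y;
  valuationD : forall x y, x != 0 -> y != 0 -> x + y != 0 ->
    Num.min (val_fun x) (val_fun y) <= val_fun (x + y)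
}.

Definition vge (F : fieldType) (T : realDomainType) (v : valuation F T)
  (x : F) (c : T) : bool := (x == 0) || (c <= v x).

Section ValuationRing.
Variables (F : fieldType) (T : realDomainType) (v : valuation F T).

Definition valring : {pred F} := [pred x | vge v x 0].

Lemma valuation1 : v 1 = 0.
Proof.
have := @valuationM _ _ v 1 1 (oner_neq0 _) (oner_neq0 _).
by rewrite mulr1 => /eqP; rewrite -subr_eq0 opprD addNKr oppr_eq0 => /eqP.
Qed.

Lemma valuationN1 : v (-1) = 0.
Proof.
have n0 : (-1 : F) != 0 by rewrite oppr_eq0 oner_neq0.
have := @valuationM _ _ v (-1) (-1) n0 n0.
rewrite mulrNN mulr1 valuation1 => /esym/eqP.
by rewrite -mulr2n mulrn_eq0 /= => /eqP.
Qed.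

Lemma valring_subring : subring_closed valring.
Proof.
have mulP : {in valring &, forall x y, x * y \in valring}.
  move=> x y; rewrite !inE /vge.
  have [->|x0 /= vx] := eqVneq x 0; first by rewrite mul0r eqxx.
  have [->|y0 /= vy] := eqVneq y 0; first by rewrite mulr0 eqxx.
  by rewrite valuationM // addr_ge0 ?orbT.
have opP : {in valring, forall x, - x \in valring}.
  move=> x vx; rewrite -mulN1r mulP // inE /vge valuationN1 lexx orbT //.
split; [|move=> x y vx /opP|exact: mulP].
  by rewrite inE /vge valuation1 lexx orbT.
move: (- y) => {}y; move: vx; rewrite !inE /vge.
have [->|x0 /= vx] := eqVneq x 0; first by rewrite add0r.
have [->|y0 /= vy] := eqVneq y 0; first by rewrite addr0 vx orbT.
have [//|s0 /=] := eqVneq (x + y) 0.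
by apply: le_trans (valuationD v x0 y0 s0); rewrite le_min vx.
Qed.

HB.instance Definition _ := GRing.isSubringClosed.Build F valring
  valring_subring.

Definition integers := {x : F | x \in valring}.
HB.instance Definition _ := SubChoice.on integers.
HB.instance Definition _ := [SubChoice_isSubComNzRing of integers by <:].

(* p ^ k O; the division is harmless since p != 0 in all uses *)
Definition maxpow (p : F) (k : nat) : {pred F} :=
  [pred x | x / p ^+ k \in valring].

Definition ideal (p : F) (k : nat) : {pred integers} :=
  [pred x | val x \in maxpow p k].

Variables (p : F) (k : nat).

Lemma ideal_zmod : zmod_closed (ideal p k).
Proof.
split; first by rewrite unfold_in /= unfold_in /= mul0r rpred0.
move=> x y vx vy; change (val (x - y) / p ^+ k \in valring).
by rewrite rmorphB mulrBl rpredB.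
Qed.

HB.instance Definition _ := GRing.isZmodClosed.Build integers (ideal p k)
  ideal_zmod.

Lemma idealMr (a u : integers) : u \in ideal p k -> a * u \in ideal p k.
Proof.
move=> vu; change (val (a * u) / p ^+ k \in valring).
by rewrite rmorphM -mulrA rpredM // (valP a).
Qed.

(* O / p ^ k O; the library's [{ideal_quot _}] would exclude k = 0, for which
   this is the zero ring. *)
Definition res := Quotient.quot (ideal p k).
HB.instance Definition _ := EqQuotient.on res.
HB.instance Definition _ := GRing.Zmodule.on res.

Definition res_one : res := \pi_res 1.
Definition res_mul : res -> res -> res :=
  fun x y => \pi_res (repr x * repr y).

Lemma res_piD (x y : integers) : \pi_res (x + y) = \pi_res x + \pi_res y.
Proof. exact: Quotient.pi_add. Qed.

Lemma res_eqP (x y : integers) :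
  (\pi_res x == \pi_res y) = (x - y \in ideal p k).
Proof. by rewrite [RHS]Quotient.idealrBE. Qed.

Lemma res_piM (x y : integers) :
  \pi_res (x * y) = res_mul (\pi_res x) (\pi_res y).
Proof.
apply/eqP; rewrite res_eqP.
set x' := repr _; set y' := repr _.
have -> : x * y - x' * y' = y * (x - x') + x' * (y - y').
  by rewrite !mulrBr (mulrC y x) (mulrC y x') addrA subrK.
by apply: rpredD; apply: idealMr; rewrite -res_eqP reprK.
Qed.

Lemma res_mulA : associative res_mul.
Proof.
move=> x y z; rewrite -[x]reprK -[y]reprK; move: (repr x) (repr y) => {}x {}y.
rewrite -[z]reprK; move: (repr z) => {}z.
by rewrite -(res_piM y z) -(res_piM x y) -(res_piM x) -(res_piM _ z) mulrA.
Qed.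

Lemma res_mulC : commutative res_mul.
Proof. by move=> x y; rewrite /res_mul mulrC. Qed.

Lemma res_mul1 : left_id res_one res_mul.
Proof.
move=> x; rewrite -[x]reprK; move: (repr x) => {}x.
by rewrite -res_piM mul1r.
Qed.

Lemma res_mulDl : left_distributive res_mul +%R.
Proof.
move=> x y z; rewrite -[x]reprK -[y]reprK; move: (repr x) (repr y) => {}x {}y.
rewrite -[z]reprK; move: (repr z) => {}z.
by rewrite -res_piD -(res_piM x) -(res_piM y) -(res_piM _ z) mulrDl res_piD.
Qed.

HB.instance Definition _ := GRing.Zmodule_isComPzRing.Build res
  res_mulA res_mulC res_mul1 res_mulDl.

(* The canonical projection O -> O / p ^ k O, extended by 0 to F so that it
   can be composed with maps valued in F; it is meant for arguments in O. *)
Definition red (x : F) : res := \pi_res (insubd (0 : integers) x).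

End ValuationRing.

Record localField (K : fieldType) := LocalField {
  lf_val :> valuation K int;
  lf_pi : K;
  lf_pi_neq0 : lf_pi != 0;
  lf_pi_val : lf_val lf_pi = 1;
  lf_complete : forall u : nat -> K,
    (forall N : int, exists m : nat, forall i j : nat,
       (m <= i)%N -> (m <= j)%N -> vge lf_val (u i - u j) N) ->
    exists l : K, forall N : int, exists m : nat, forall i : nat,
       (m <= i)%N -> vge lf_val (u i - l) N;
  lf_finite_residue : finite_set [set: res lf_val lf_pi 1]
}.

(* The valuation of L is a priori rational-valued; the extension is unramified
   when its value group is that of K (the residue extension is separable,
   since the residue field of K is finite). *)
Record unramifiedGalois (K : fieldType) (V : localField K)
    (L : splittingFieldType K) := UnramifiedGalois {
  ug_val :> valuation L rat;
  ug_extends : forall x : K, x != 0 -> ug_val x%:A = (V x)%:~R;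
  ug_galois : galois 1 {:L};
  ug_unramified : forall x : L, x != 0 ->
    exists2 y : K, y != 0 & ug_val x = ug_val y%:A
}.

Section Extension.
Variables (K : fieldType) (V : localField K) (L : splittingFieldType K).
Variable E : unramifiedGalois V L.

Definition intK := integers V.
Definition intL := integers E.
Definition maxpowK (k : nat) : {pred K} := maxpow V (lf_pi V) k.
Definition maxpowL (k : nat) : {pred L} := maxpow E (lf_pi V)%:A k.

Definition resK (k : nat) := res V (lf_pi V) k.
HB.instance Definition _ k := EqQuotient.on (resK k).
HB.instance Definition _ k := GRing.ComPzRing.on (resK k).

Definition resL (k : nat) := res E (lf_pi V)%:A k.
HB.instance Definition _ k := EqQuotient.on (resL k).
HB.instance Definition _ k := GRing.ComPzRing.on (resL k).

Definition redK (k : nat) : K -> resK k := red V (lf_pi V) k.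
Definition redL (k : nat) : L -> resL k := red E (lf_pi V)%:A k.

Lemma valring_ext (x : K) : x \in valring V -> x%:A \in valring E.
Proof.
rewrite !inE /vge; have [->|x0 /= vx] := eqVneq x 0.
  by rewrite scale0r eqxx.
by rewrite ug_extends // ler0z vx orbT.
Qed.

Definition int_ext (x : intK) : intL :=
  exist (fun y => y \in valring E) (val x)%:A (valring_ext (valP x)).

Definition res_ext (k : nat) (x : resK k) : resL k :=
  \pi_(resL k) (int_ext (repr x)).

Lemma res_ext_pi k (x : intK) :
  res_ext (\pi_(resK k) x) = \pi_(resL k) (int_ext x).
Proof.
apply/eqP; rewrite /res_ext res_eqP; set y := repr _.
have /valring_ext : (val y - val x) / lf_pi V ^+ k \in valring V.
  by change (y - x \in ideal (lf_pi V) k); rewrite -res_eqP reprK.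
by rewrite -in_algE rmorphM fmorphV rmorphXn rmorphB.
Qed.

Lemma res_ext1 k : res_ext (1 : resK k) = 1.
Proof.
have -> : 1 = \pi_(resK k) (1 : intK) by [].
rewrite res_ext_pi; congr (\pi_(resL k) _).
by apply: val_inj; rewrite /= scale1r.
Qed.

Lemma res_extD k (x y : resK k) : res_ext (x + y) = res_ext x + res_ext y.
Proof.
rewrite -[x]reprK -[y]reprK; move: (repr x) (repr y) => {}x {}y.
rewrite -[X in res_ext X]res_piD !res_ext_pi.
rewrite -[RHS]res_piD; congr (\pi_(resL k) _).
by apply: val_inj; rewrite /= scalerDl.
Qed.

Lemma res_extM k (x y : resK k) : res_ext (x * y) = res_ext x * res_ext y.
Proof.
rewrite -[x]reprK -[y]reprK; move: (repr x) (repr y) => {}x {}y.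
rewrite -[X in res_ext X]res_piM !res_ext_pi.
rewrite -[RHS]res_piM; congr (\pi_(resL k) _).
by apply: val_inj; rewrite /= -in_algE rmorphM.
Qed.

Definition res_scale k (c : resK k) (x : resL k) : resL k := res_ext c * x.

Lemma res_scaleA k (a b : resK k) (x : resL k) :
  res_scale a (res_scale b x) = res_scale (a * b) x.
Proof. by rewrite /res_scale res_extM mulrA. Qed.

Lemma res_scale1 k : left_id (1 : resK k) (@res_scale k).
Proof. by move=> x; rewrite /res_scale res_ext1 mul1r. Qed.

Lemma res_scaleDr k : right_distributive (@res_scale k) +%R.
Proof. by move=> a x y; rewrite /res_scale mulrDr. Qed.

Lemma res_scaleDl k (x : resL k) :
  {morph (@res_scale k)^~ x : a b / a + b}.
Proof. by move=> a b; rewrite /res_scale res_extD mulrDl. Qed.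

HB.instance Definition _ k := GRing.Zmodule_isLmodule.Build (resK k) (resL k)
  (@res_scaleA k) (@res_scale1 k) (@res_scaleDr k) (@res_scaleDl k).

(* As L / K is Galois, [gal_of {:L}] is the whole Galois group of L / K. *)
Definition galG : finGroupType := gal_of {:L}.

Definition gal_res (k : nat) (g : galG) (x : resL k) : resL k :=
  redL k (g (val (repr x))).

(* An element sum_g a_g g of a skew group algebra S[G] is the function
   g |-> a_g. The group law of [gal_of] composes from left to right:
   (h * g)%g x = g (h x), so the product written gh on paper is (h * g)%g. *)
Definition skew_mul (S : pzRingType) (act : galG -> S -> S)
    (a b : {ffun galG -> S}) : {ffun galG -> S} :=
  [ffun c =>
    \sum_(g : galG) \sum_(h : galG | (h * g)%g == c) a g * act g (b h)].

Definition skew_mulL :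
    {ffun galG -> L} -> {ffun galG -> L} -> {ffun galG -> L} :=
  skew_mul (fun g x => g x).
Definition skew_mul_res (k : nat) :
    {ffun galG -> resL k} -> {ffun galG -> resL k} -> {ffun galG -> resL k} :=
  skew_mul (@gal_res k).

(* m_L^k[G] as a subset of L[G]; O_L[G] is the case k = 0 *)
Definition skewI (k : nat) : set {ffun galG -> L} :=
  [set a | forall g, a g \in maxpowL k]%classic.

Definition EndI (k : nat) : set 'End(L) :=
  [set f : 'End(L) | forall x, x \in valring E -> f x \in maxpowL k]%classic.

Definition MatI (n k : nat) : set 'M[K]_n :=
  [set M : 'M[K]_n | forall i j, M i j \in maxpowK k]%classic.

Definition skew_red (k : nat) (a : {ffun galG -> L}) : {ffun galG -> resL k} :=
  [ffun g => redL k (a g)].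

Definition End_red (k : nat) (f : 'End(L)) : resL k -> resL k :=
  fun x => redL k (f (val (repr x))).

Definition Mat_red (n k : nat) (M : 'M[K]_n) : 'M[resK k]_n :=
  map_mx (redK k) M.

Definition End_res (k : nat) : set (resL k -> resL k) :=
  [set f : resL k -> resL k | linear f]%classic.

Definition phi (a : {ffun galG -> L}) : 'End(L) :=
  linfun (fun x : L => \sum_(g : galG) a g * g x).

Definition phi_res (k : nat) (a : {ffun galG -> resL k}) : resL k -> resL k :=
  fun x => \sum_(g : galG) a g * gal_res g x.

Definition integral_basis (n : nat) (alpha : n.-tuple L) : Prop :=
  [/\ basis_of {:L} alpha,
      forall i, tnth alpha i \in valring E
    & forall x : intL, exists! c : {ffun 'I_n -> intK},
        val x = \sum_(i < n) val (c i) *: tnth alpha i].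

(* Matrices act on column vectors, so that composition becomes product. *)
Definition psi (n : nat) (alpha : n.-tuple L) (f : 'End(L)) : 'M[K]_n :=
  \matrix_(i, j) coord alpha i (f (tnth alpha j)).

End Extension.

Arguments maxpowK {K} V k.
Arguments maxpowL {K V L} E k.
Arguments redK {K} V k x.
Arguments redL {K V L} E k x.
Arguments gal_res {K V L} E k g x.
Arguments skew_mulL {K} L a b.
Arguments skew_mul_res {K V L} E k a b.
Arguments skew_red {K V L} E k a.
Arguments End_red {K V L} E k f x.
Arguments Mat_red {K} V {n} k M.
Arguments MatI {K} V n k M.
Arguments End_res {K V L} E k f.
Arguments phi {K} L a.
Arguments phi_res {K V L} E k a x.

Definition module_basis (R : pzRingType) (M : lmodType R) (n : nat)
    (b : 'I_n -> M) : Prop :=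
  forall x : M, exists! c : {ffun 'I_n -> R}, x = \sum_(i < n) c i *: b i.

(* the matrix of f with respect to b (unique when b is a basis) *)
Definition matrix_of (R : pzRingType) (M : lmodType R) (n : nat)
    (b : 'I_n -> M) (f : M -> M) : 'M[R]_n :=
  xget 0 [set A : 'M[R]_n |
    forall j, f (b j) = \sum_(i < n) A i j *: b i]%classic.

Definition basis_res (K : fieldType) (V : localField K)
    (L : splittingFieldType K) (E : unramifiedGalois V L) (n k : nat)
    (alpha : n.-tuple L) : 'I_n -> resL E k :=
  fun i => redL E k (tnth alpha i).

Definition psi_res (K : fieldType) (V : localField K)
    (L : splittingFieldType K) (E : unramifiedGalois V L) (n k : nat)
    (alpha : n.-tuple L) : (resL E k -> resL E k) -> 'M[resK V k]_n :=
  matrix_of (basis_res E k alpha).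
Arguments psi_res {K V L} E {n} k alpha f.

Section Diagrams.
Variables (R R' : pzRingType) (X : lmodType R) (Y : lmodType R').
Variables (mulX : X -> X -> X) (mulY : Y -> Y -> Y).

(* f is on A a homomorphism of (not necessarily unital) algebras, semilinear
   along s for the scalars in O *)
Definition hom_on (O : {pred R}) (s : R -> R') (A : set X) (f : X -> Y) :
    Prop :=
  [/\ forall x y, A x -> A y -> f (x + y) = f x + f y,
      forall c x, c \in O -> A x -> f (c *: x) = s c *: f x
    & forall x y, A x -> A y -> f (mulX x y) = mulY (f x) (f y)].

(* exactness of 0 -> A -> B -> C -> 0, where A -> B is the inclusion and
   B -> C is the restriction of p *)
Definition short_exact (A B : set X) (C : set Y) (p : X -> Y) : Prop :=
  [/\ A `<=` B, A = [set x | B x /\ p x = 0] & p @` B = C]%classic.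

End Diagrams.

Definition iso_on (R : pzRingType) (X Y : lmodType R) (mulX : X -> X -> X)
    (mulY : Y -> Y -> Y) (O : {pred R}) (A : set X) (B : set Y) (f : X -> Y) :
    Prop :=
  hom_on mulX mulY O id A f /\ set_bij A B f.

(* Main.v *)
From HB Require Import structures.
Require Import Defs.
From mathcomp Require Import all_boot all_order all_algebra all_fingroup all_field.
From mathcomp Require Import generic_quotient.
From mathcomp Require Import boolp classical_sets functions cardinality.
Import Order.TTheory GRing.Theory Num.Theory.
Local Open Scope ring_scope.
Local Open Scope classical_set_scope.
Local Open Scope quotient_scope.
Set Implicit Arguments.
Unset Strict Implicit.
Unset Printing Implicit Defensive.

(** The heart of the matter is that [phi] identifies [m_L^k[G]] with [End_K^k(L)]
    for every [k], i.e. that an element of [L[G]] acting integrally has integral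
    coefficients.  This holds because the integers of [L] have Galois
    coordinates: finitely many integral pairs [(x_i, y_i)] such that
    [sum_i x_i g(y_i)] is 1 for [g = 1] and 0 for every other [g]
    ([galois_coordinates]).  Indeed, if [f = sum_g a_g g] then
    [a_h = sum_i h(x_i) f(y_i)], which gives injectivity and the divisibility of
    the coefficients at once; conversely the element of [L[G]] with these
    coefficients acts as [f], because [f] is linear for the trace form
    ([phiK], [phi_invK], [phi_bij]).

    Galois coordinates exist as soon as every [g != 1] moves some integer [x] by
    a unit, since then the products of the functions
    [h |-> (g x - h x) / (g x - x)] separate the identity from the rest of [G].
    This in turn is the triviality of inertia ([inertia_trivial]).  Since [pi] is
    still a uniformizer of [L] and the residue field of [L] is finite, with [Q]
    elements say, [x ^ Q] is congruent to [x] and [Q] to 0 modulo [pi].  If [g]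
    is the identity modulo [pi ^ j], with [j > 0], comparing [g x] and [x] through
    their [Q]-th powers shows that it is the identity modulo [pi ^ (j + 1)], so by
    induction an element of inertia is the identity ([inertia_step]).  That [G]
    preserves the integers at all is seen on powers: they stay in a finitely
    generated module ([gal_valring]).

    The maps [psi] are governed by coordinates: an element of [L] is divisible by
    [pi ^ k] exactly when all its coordinates in the integral basis are
    ([maxpowL_coord]).  The rows are exact because the reductions are surjective
    and, for endomorphisms, because matrices can be lifted entrywise
    ([End_exact]).  The two isomorphisms in the residual column then follow from
    the other two columns by a five lemma ([iso_on_quotient]). *)

(** * Congruences in a valuation ring and the reduction map *)

Section Reduction.
Variables (F : fieldType) (T : realDomainType) (v : valuation F T).
Variable p : F.
Implicit Types (k : nat) (x y : F).

Lemma maxpowE k x : (x \in maxpow v p k) = (x / p ^+ k \in valring v).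
Proof. by []. Qed.

Lemma maxpow0 x : (x \in maxpow v p 0) = (x \in valring v).
Proof. by rewrite maxpowE expr0 divr1. Qed.

Lemma maxpow_zmod k : zmod_closed (maxpow v p k).
Proof.
split=> [|x y]; rewrite !maxpowE ?mul0r ?rpred0 // => vx vy.
by rewrite mulrBl rpredB.
Qed.

HB.instance Definition _ k := GRing.isZmodClosed.Build F (maxpow v p k)
  (maxpow_zmod k).

Lemma maxpowMl k x y :
  x \in valring v -> y \in maxpow v p k -> x * y \in maxpow v p k.
Proof. by rewrite !maxpowE -mulrA => vx vy; rewrite rpredM. Qed.

Lemma maxpowM j k x y :
  x \in maxpow v p j -> y \in maxpow v p k -> x * y \in maxpow v p (j + k).
Proof.
by rewrite !maxpowE => vx vy; rewrite exprD invfM mulrACA rpredM.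
Qed.

Lemma maxpow_leq j k x :
  p \in valring v -> p != 0 -> (j <= k)%N ->
  x \in maxpow v p k -> x \in maxpow v p j.
Proof.
move=> vp p0 jk; rewrite !maxpowE => vx.
rewrite -(mulfVK (expf_neq0 (k - j) p0) (x / _)) rpredM ?rpredX //.
by rewrite -mulrA -invfM -exprD subnKC.
Qed.

Section Fixed.
Variable k : nat.
Local Notation red := (red v p k).

Lemma red_val (x : integers v) : red (val x) = \pi_(res v p k) x.
Proof. by rewrite /red valKd. Qed.

Lemma integersP x : x \in valring v -> exists x' : integers v, x = val x'.
Proof. by move=> vx; exists (exist _ x vx). Qed.

Lemma red_eq x y : x \in valring v -> y \in valring v ->
  red x = red y <-> x - y \in maxpow v p k.
Proof.
move=> /integersP[{}x ->] /integersP[{}y ->]; rewrite !red_val.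
have -> : (val x - val y \in maxpow v p k) = (x - y \in ideal p k) by [].
by rewrite -res_eqP; split=> /eqP.
Qed.

(** [red] is defined on the whole field but is a ring morphism on the valuation
    ring only, whence the membership conditions. *)
Lemma redD x y : x \in valring v -> y \in valring v ->
  red (x + y) = red x + red y.
Proof.
move=> /integersP[{}x ->] /integersP[{}y ->].
by rewrite -rmorphD !red_val res_piD.
Qed.

Lemma redM x y : x \in valring v -> y \in valring v ->
  red (x * y) = red x * red y.
Proof.
move=> /integersP[{}x ->] /integersP[{}y ->].
by rewrite -rmorphM !red_val res_piM.
Qed.

Lemma red0 : red 0 = 0.
Proof.
by apply: (addIr (red 0)); rewrite -redD ?rpred0 // addr0 add0r.
Qed.

Lemma red1 : red 1 = 1.
Proof. exact: (red_val 1). Qed.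

Lemma red_eq0 x : x \in valring v -> red x = 0 <-> x \in maxpow v p k.
Proof. by move=> vx; rewrite -red0 red_eq ?rpred0 // subr0. Qed.

Lemma red_sum (I : finType) (P : pred I) (f : I -> F) :
  (forall i, P i -> f i \in valring v) ->
  red (\sum_(i | P i) f i) = \sum_(i | P i) red (f i).
Proof.
move=> vf; suff []: red (\sum_(i | P i) f i) = \sum_(i | P i) red (f i)
  /\ \sum_(i | P i) f i \in valring v by [].
apply: (big_rec2 (fun z x => red x = z /\ x \in valring v)).
  by rewrite red0 rpred0.
by move=> i z x Pi [<- vx]; rewrite redD ?vf // rpredD ?vf.
Qed.

Lemma redX n x : x \in valring v -> red (x ^+ n) = red x ^+ n.
Proof.
move=> vx; elim: n => [|n IHn]; first exact: red1.
by rewrite !exprS redM ?rpredX // IHn.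
Qed.

Lemma red_surj (z : res v p k) : exists2 x, x \in valring v & red x = z.
Proof. by exists (val (repr z)); rewrite ?(valP (repr z)) // red_val reprK. Qed.

End Fixed.
End Reduction.

(** * Finite domains *)

Lemma perm_map_inj (T : eqType) (f : T -> T) (s : seq T) :
  injective f -> uniq s -> {subset map f s <= s} -> perm_eq (map f s) s.
Proof.
move=> fI us fs; have ufs : uniq (map f s) by rewrite map_inj_uniq.
by apply: uniq_perm => //; case: (uniq_min_size ufs fs); rewrite ?size_map.
Qed.

Section FiniteDomain.
Variable R : comPzRingType.
Hypothesis one_neq0 : 1 != 0 :> R.
Hypothesis domR : forall x y : R, x * y = 0 -> x != 0 -> y = 0.
Variable s : seq R.
Hypothesis sP : forall x, x \in s.

(** This is Lagrange's theorem for the additive and the multiplicative group of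
    the finite field [R], with [Q] its cardinality: translation by 1 and
    multiplication by a nonzero [x] permute the (nonzero) elements, and the sum,
    resp. the product, of all of them is unchanged.  The domain property is a
    hypothesis because the ring it is meant for, the residue ring of a valuation
    ring, carries only a ring structure. *)
Lemma finite_domain_expr :
  exists Q : nat, Q%:R = 0 :> R /\ forall x : R, x ^+ Q = x.
Proof.
set t := undup s.
have tP x : x \in t by rewrite mem_undup.
have ut : uniq t by apply: undup_uniq.
exists (size t); split.
  have : \sum_(y <- t) (y + 1) = \sum_(y <- t) y.
    rewrite -(big_map (fun y => y + 1) predT id).
    by apply/perm_big/perm_map_inj => //; apply: addIr.
  rewrite big_split /= => /(canRL (addKr _)); rewrite addNr.
  by rewrite big_const_seq count_predT iter_addr_0.
pose t' := [seq y <- t | y != 0].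
have st : size t = (size t').+1.
  rewrite -(count_predC (pred1 0) t) count_uniq_mem // tP.
  by rewrite size_filter.
have pt' : \prod_(y <- t') y != 0.
  rewrite big_filter; elim/big_rec: _ => // x y x0 y0.
  by apply: contra_neq y0 => xy; apply: domR xy x0.
move=> x; have [->|x0] := eqVneq x 0; first by rewrite st exprS mul0r.
have xI : injective ( *%R x).
  move=> a b ab; apply/eqP; rewrite -subr_eq0; apply/eqP.
  by apply: domR x0; rewrite mulrBr ab subrr.
suff x1 : x ^+ size t' = 1 by rewrite st exprS x1 mulr1.
have : \prod_(y <- t') (x * y) = \prod_(y <- t') y.
  rewrite -(big_map ( *%R x) predT id).
  apply/perm_big/perm_map_inj; rewrite ?filter_uniq //.
  move=> _ /mapP[y yt ->]; move: yt; rewrite !mem_filter !tP !andbT => y0.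
  by apply: contra_neq y0 => /domR; apply.
rewrite big_split /= big_const_seq count_predT iter_mulr_1 => xP.
apply/eqP; rewrite -subr_eq0; apply/eqP.
apply: (domR _ pt'); rewrite mulrBr mulr1 mulrC xP subrr //.
Qed.

End FiniteDomain.

(** * Valuations *)

Section Valuation.
Variables (F : fieldType) (T : realDomainType) (v : valuation F T).
Implicit Types x : F.

Lemma valringE x : (x \in valring v) = (x == 0) || (0 <= v x).
Proof. by []. Qed.

Lemma valuationX n x : x != 0 -> v (x ^+ n) = v x *+ n.
Proof.
move=> x0; elim: n => [|n IHn]; first by rewrite valuation1.
by rewrite exprS mulrS valuationM ?expf_neq0 // IHn.
Qed.

Lemma valuationV x : x != 0 -> v x^-1 = - v x.
Proof.
move=> x0; apply/eqP; rewrite -subr_eq0 opprK -valuationM ?invr_eq0 //.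
by rewrite mulVf // valuation1.
Qed.

Lemma valring_or_inv x : x \in valring v \/ x^-1 \in valring v.
Proof.
rewrite !valringE; have [->|x0] := eqVneq x 0; first by left.
rewrite valuationV // oppr_ge0 orbC.
by case: (lerP 0 (v x)) => [|/ltW ->]; [left|right; rewrite orbT].
Qed.

End Valuation.

(** * The integers of an unramified extension *)

Section Extension.
Variables (K : fieldType) (V : localField K) (L : splittingFieldType K).
Variable E : unramifiedGalois V L.
Local Notation p := (lf_pi V).
Local Notation P := ((lf_pi V)%:A : L).
Local Notation OL := (valring E).
Local Notation OK := (valring V).

Lemma piL_neq0 : P != 0.
Proof. by rewrite scaler_eq0 (negPf (lf_pi_neq0 V)) oner_eq0. Qed.
Hint Resolve piL_neq0 : core.

Lemma val_piL : E P = 1.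
Proof. by rewrite ug_extends ?lf_pi_neq0 // lf_pi_val. Qed.

Lemma piK_int : p \in OK.
Proof. by rewrite valringE lf_pi_val ler01 orbT. Qed.

Lemma piL_int : P \in OL.
Proof. by apply/valring_ext/piK_int. Qed.

(** This is where unramifiedness enters: it makes [pi] a uniformizer of [L], so
    that integers not divisible by [pi] are units. *)
Lemma val_int x : x != 0 -> exists m : int, E x = m%:~R.
Proof.
move=> /(ug_unramified E)[y y0 ->]; exists (V y).
by rewrite ug_extends.
Qed.

Lemma val_piLX j : E (P ^+ j) = j%:R.
Proof. by rewrite valuationX ?val_piL. Qed.

Lemma mem_maxpowL k x :
  x != 0 -> (x \in maxpowL E k) = (k%:R <= E x).
Proof.
move=> x0; rewrite maxpowE valringE mulf_eq0 invr_eq0 expf_eq0.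
rewrite (negPf x0) (negPf piL_neq0) andbF /=.
by rewrite valuationM ?valuationV ?invr_eq0 ?expf_neq0 // val_piLX subr_ge0.
Qed.

Lemma unit_modpi x : x \in OL -> x \notin maxpowL E 1 -> x^-1 \in OL.
Proof.
have [->|x0] := eqVneq x 0; first by rewrite invr0.
rewrite mem_maxpowL // !valringE invr_eq0 (negPf x0) /= => _.
rewrite -ltNge valuationV // oppr_ge0; have [m ->] := val_int x0.
by rewrite ltrz1 lerz0 -[1]add0r ltzD1.
Qed.

(** Krull's intersection theorem for the ideal of [pi]. *)
Lemma maxpowL_sep x : (forall j, x \in maxpowL E j) -> x = 0.
Proof.
move=> xP; apply/eqP/negPn/negP => x0.
have [m Em] := val_int x0; have := xP `|m|.+1; rewrite mem_maxpowL // Em.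
rewrite -[_.+1%:R]/(_.+1%:Z%:~R) ler_int leNgt => /negP[].
by rewrite intS addrC ltzD1 abszE ler_norm.
Qed.

Lemma piL_denominator x : exists m, P ^+ m * x \in OL.
Proof.
have [->|x0] := eqVneq x 0; first by exists 0; rewrite mulr0 rpred0.
have [m Em] := val_int x0; exists `|m|%N.
rewrite valringE valuationM ?expf_neq0 // val_piLX Em.
by rewrite natr_absz -rmorphD ler0z -lerBlDr sub0r -normrN ler_norm orbT.
Qed.

(** Integral closedness in a usable form: if [x] had negative valuation, at most
    [-1], then [x ^+ m.+1] would already have a pole of order more than [m]. *)
Lemma valring_of_bounded_powers (m : nat) x :
  (forall j, P ^+ m * x ^+ j \in OL) -> x \in OL.
Proof.
have [->|x0 xP] := eqVneq x 0; first by rewrite rpred0.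
have := xP m.+1; rewrite !valringE !mulf_eq0 !expf_eq0.
rewrite (negPf x0) (negPf piL_neq0) !andbF /=.
rewrite valuationM ?valuationX ?expf_neq0 // val_piL.
have [z ->] := val_int x0.
rewrite -[1 *+ m]/(m%:Z%:~R : rat) -rmorphMn -rmorphD !ler0z => h.
rewrite leNgt; apply/negP => z0; move: h; rewrite leNgt => /negP[].
have z1 : z <= -1 by rewrite -(lerD2r 1) addNr -ltzD1 ltrD2r.
have := lerMn2r m.+1 z (-1); rewrite z1 => zm.
apply: (@le_lt_trans _ _ (m%:Z + (-1) *+ m.+1)); first by rewrite lerD2l zm.
by rewrite mulNrn natz intS opprD addrCA subrr addr0.
Qed.

Lemma gal_scale (g : galG L) (c : K) x : g (c *: x) = c *: g x.
Proof. exact: linearZ. Qed.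

Lemma gal_alg (g : galG L) (c : K) : g c%:A = c%:A.
Proof. by rewrite gal_scale rmorph1. Qed.

Lemma maxpowL_scale k (c : K) x :
  c \in OK -> x \in maxpowL E k -> c *: x \in maxpowL E k.
Proof. by move=> cO xP; rewrite -mulr_algl maxpowMl // valring_ext. Qed.

Lemma valringZ (c : K) x : c \in OK -> x \in OL -> c *: x \in OL.
Proof. by move=> cO xO; rewrite -mulr_algl rpredM // valring_ext. Qed.

Section Basis.
Variables (n : nat) (alpha : n.-tuple L).
Hypothesis int_alpha : integral_basis E alpha.

Lemma alpha_int i : tnth alpha i \in OL.
Proof. by case: int_alpha. Qed.
Hint Resolve alpha_int : core.

Lemma coordK x : x = \sum_(i < n) coord alpha i x *: tnth alpha i.
Proof.
case: int_alpha => /coord_basis/(_ (memvf x)) {1}-> _ _.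
by apply: eq_bigr => i _; rewrite (tnth_nth 0).
Qed.

Lemma coord_comb (c : 'I_n -> K) i :
  coord alpha i (\sum_(j < n) c j *: tnth alpha j) = c i.
Proof.
case: int_alpha => /basis_free fr _ _; rewrite -[RHS](coord_sum_free c i fr).
by congr (coord _ _ _); apply: eq_bigr => j _; rewrite (tnth_nth 0).
Qed.

Lemma valring_coord x : x \in OL <-> forall i, coord alpha i x \in OK.
Proof.
split=> [xO i|cO]; last first.
  by rewrite [x]coordK rpred_sum // => i _; apply: valringZ.
case: int_alpha => _ _ /(_ (exist _ x xO))[c [/= -> _]].
by rewrite (coord_comb (fun i => val (c i))) (valP (c i)).
Qed.

Lemma maxpowL_coord k x :
  x \in maxpowL E k <-> forall i, coord alpha i x \in maxpowK V k.
Proof.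
rewrite maxpowE.
have -> : x / P ^+ k = p ^- k *: x.
  by rewrite mulrC -[RHS]mulr_algl -!in_algE fmorphV rmorphXn.
rewrite valring_coord; split=> xO i; have := xO i.
  by rewrite linearZ /= maxpowE mulrC.
by rewrite linearZ /= maxpowE mulrC.
Qed.

(** The valuation of [L] is Galois invariant.  All powers of an integral [x] are
    integral combinations of the finite family [alpha], hence those of [g x] are
    integral combinations of the family [g alpha], which has a common
    denominator. *)
Lemma gal_valring (g : galG L) x : x \in OL -> g x \in OL.
Proof.
(* the sum of the exponents of denominators is at least each of them *)
have [m mP] : exists m, forall i, P ^+ m * g (tnth alpha i) \in OL.
  have [f fP] := choice (fun i => piL_denominator (g (tnth alpha i))).
  exists (\sum_i f i)%N => i; rewrite (bigD1 i) //= addnC exprD -mulrA.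
  by rewrite rpredM // rpredX // piL_int.
move=> xO; apply: (@valring_of_bounded_powers m) => j.
have -> : g x ^+ j = g (x ^+ j) by rewrite rmorphXn.
have: x ^+ j \in OL by rewrite rpredX.
move: (x ^+ j) => y /valring_coord yO.
have -> : g y = \sum_i coord alpha i y *: g (tnth alpha i).
  rewrite {1}[y]coordK linear_sum; apply: eq_bigr => i _.
  exact: gal_scale.
rewrite mulr_sumr rpred_sum // => i _.
by rewrite -scalerAr valringZ.
Qed.

Lemma gal_maxpowL (g : galG L) k x : x \in maxpowL E k -> g x \in maxpowL E k.
Proof.
rewrite !maxpowE => /(gal_valring g).
suff -> : g (x / P ^+ k) = g x / P ^+ k by [].
rewrite rmorphM fmorphV rmorphXn /=; congr (_ / _ ^+ _); exact: gal_alg.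
Qed.

End Basis.
End Extension.

(** * Triviality of inertia and Galois coordinates *)

Section Faithful.
Variables (K : fieldType) (V : localField K) (L : splittingFieldType K).
Variable E : unramifiedGalois V L.
Local Notation p := (lf_pi V).
Local Notation P := ((lf_pi V)%:A : L).
Local Notation OL := (valring E).
Local Notation OK := (valring V).

Lemma redL_scale k (c : K) x :
  c \in OK -> x \in OL -> redL E k (c *: x) = redK V k c *: redL E k x.
Proof.
move=> /integersP[{}c ->] xO; rewrite /redL /redK red_val.
have -> : val c *: x = val (int_ext E c) * x by rewrite mulr_algl.
rewrite redM ?(valP (int_ext E c)) // red_val.
by rewrite -[RHS]/(res_ext E _ * _) res_ext_pi.
Qed.

Variables (n : nat) (alpha : n.-tuple L).
Hypothesis int_alpha : integral_basis E alpha.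

Lemma redL_coord k x : x \in OL ->
  redL E k x =
  \sum_(i < n) redK V k (coord alpha i x) *: redL E k (tnth alpha i).
Proof.
move=> xO; rewrite {1}[x](coordK int_alpha) /redL.
have cO := (valring_coord int_alpha x).1 xO.
have aO := alpha_int int_alpha.
rewrite red_sum => [|i _]; last exact: valringZ.
by apply: eq_bigr => i _; exact: redL_scale.
Qed.

(** The residue ring of [L] is generated as a module over the finite residue ring
    of [K] by the images of [alpha]. *)
Lemma finite_resL1 : exists s : seq (resL E 1), forall z, z \in s.
Proof.
have /finite_seqP[s sT] := lf_finite_residue V.
have sP x : x \in s by have : [set` s] x by rewrite -sT.
pose t := [seq \sum_i (val (c i) : resK V 1) *: redL E 1 (tnth alpha i)
  | c : {ffun 'I_n -> seq_sub s}].
exists t => z; have [x xO <-] := red_surj z.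
rewrite [red _ _ _ _](redL_coord 1 xO).
apply/mapP; exists [ffun i => SeqSub (sP (redK V 1 (coord alpha i x)))].
  by rewrite mem_enum.
by apply: eq_bigr => i _; rewrite ffunE.
Qed.

Lemma residue_power : exists Q : nat, Q%:R \in maxpowL E 1 /\
  forall x, x \in OL -> x ^+ Q - x \in maxpowL E 1.
Proof.
have [s sP] := finite_resL1.
have [||Q [Q0 xQ]] := @finite_domain_expr (resL E 1) _ _ s sP.
- apply/negP => /eqP; rewrite -(red1 E P 1) => /(red_eq0 _ _ (rpred1 _)).
  by rewrite -/(maxpowL E 1) mem_maxpowL ?oner_neq0 // valuation1 ler10.
- move=> z w; have [x xO <-] := red_surj z; have [y yO <-] := red_surj w.
  rewrite -redM // => /(red_eq0 _ _ (rpredM xO yO)) xyP.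
  move=> z0; have {z0} xP : x \notin maxpowL E 1.
    by apply: contra_neqN z0; apply: (red_eq0 _ _ xO).2.
  have xV := unit_modpi xO xP.
  have [x0|x0] := eqVneq x 0; first by case/negP: xP; rewrite x0 rpred0.
  by apply/red_eq0; rewrite // -(mulKf x0 y) maxpowMl.
exists Q; split.
  apply/red_eq0; first by rewrite rpred_nat.
  rewrite -{}Q0; elim: (Q) => [|m IHm]; first exact: red0.
  by rewrite -!natr1 redD ?rpred_nat ?rpred1 // IHm red1.
by move=> x xO; apply/red_eq; rewrite ?rpredX // redX // xQ.
Qed.

(** The power map [x |-> x ^+ Q] is the identity modulo [pi] and contracts
    congruences.  Writing [x = x ^+ Q - pi z], the difference [g x - x] is that
    of the [Q]-th powers of [g x] and [x], of which the quotient by [g x - x] is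
    congruent to [Q x ^+ (Q - 1)] and hence to 0 modulo [pi], minus
    [pi (g z - z)]. *)
Lemma inertia_step (g : galG L) j :
  (forall x, x \in OL -> g x - x \in maxpowL E j.+1) ->
  forall x, x \in OL -> g x - x \in maxpowL E j.+2.
Proof.
move=> gP x xO; have [Q [Q0 xQ]] := residue_power.
have gO := gal_valring int_alpha g.
have [z zO xE] : exists2 z, z \in OL & x = x ^+ Q - P * z.
  exists ((x ^+ Q - x) / P); last first.
    by rewrite mulrC divfK ?piL_neq0 // opprB addrC subrK.
  by have := xQ x xO; rewrite maxpowE expr1.
have -> : g x - x = (g x ^+ Q - x ^+ Q) - P * (g z - z).
  rewrite {1 2}xE rmorphB rmorphM rmorphXn /= gal_alg mulrBr.
  by rewrite !opprD !opprK addrACA.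
rewrite rpredB //; last first.
  rewrite -add1n; apply: maxpowM (gP z zO).
  by rewrite maxpowE expr1 divff ?piL_neq0 ?rpred1.
rewrite subrXX -addn1; apply: maxpowM (gP x xO) _.
have sO : \sum_(i < Q) g x ^+ (Q.-1 - i) * x ^+ i \in OL.
  by apply: rpred_sum => i _; rewrite rpredM ?rpredX ?gO.
apply/(red_eq0 P 1 sO); rewrite red_sum => [|i _]; last first.
  by rewrite rpredM ?rpredX ?gO.
have gx : red E P 1 (g x) = red E P 1 x.
  apply/red_eq; rewrite ?gO //.
  by apply: (maxpow_leq (piL_int E) _ _ (gP x xO)); rewrite ?piL_neq0.
rewrite (eq_bigr (fun=> red E P 1 (x ^+ Q.-1))) => [|i _]; last first.
  rewrite redM ?rpredX ?gO // !redX ?gO // gx -exprD subnK //.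
  by case: Q i {Q0 xQ xE sO} => [[]//|Q] i; rewrite -ltnS ltn_ord.
rewrite sumr_const card_ord.
have Qr : red E P 1 Q%:R = 0 by apply/red_eq0; rewrite ?rpred_nat.
have <- : red E P 1 (Q%:R * x ^+ Q.-1) = red E P 1 (x ^+ Q.-1) *+ Q.
  elim: (Q) (x ^+ _) (rpredX Q.-1 xO : x ^+ Q.-1 \in OL) => [|m IHm] y yO.
    by rewrite mul0r red0.
  by rewrite -natr1 mulrDl mul1r redD ?rpredM ?rpred_nat // IHm // -mulrSr.
by rewrite redM ?rpredX ?rpred_nat // Qr mul0r.
Qed.

(** Otherwise [inertia_step] makes [g] the identity modulo every power of
    [pi]. *)
Lemma inertia_trivial (g : galG L) : g != 1%g ->
  exists2 x, x \in OL & g x - x \notin maxpowL E 1.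
Proof.
move=> g1; apply: contrapT => gN.
have gP j x : x \in OL -> g x - x \in maxpowL E j.+1.
  elim: j x => [|j IHj]; last exact: inertia_step.
  by move=> x xO; apply/negPn/negP => xP; apply: gN; exists x.
have gid x : x \in OL -> g x = x.
  move=> xO; apply/subr0_eq/(@maxpowL_sep _ _ _ E) => -[|j]; last exact: gP.
  by apply: (maxpow_leq (piL_int E) (piL_neq0 V L) _ (gP 0 x xO)).
case/negP: g1; apply/gal_eqP => x _; rewrite gal_id.
have [/gid //|/gid] := valring_or_inv E x.
by rewrite fmorphV => /invr_inj.
Qed.

(** The integers of [L] are a Galois extension, in the sense of rings, of those
    of [K].  The sums [sum_u u.1 * g u.2], as functions of [g], form a ring.  For
    every [g != 1] some [g x - x] is a unit of the ring of integers, and the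
    two-term sum [h |-> (g x - h x) / (g x - x)] is 1 at the identity and
    vanishes at [g]; the product of these functions is the delta function. *)
Lemma galois_coordinates : exists s : seq (L * L),
  (forall u, u \in s -> u.1 \in OL /\ u.2 \in OL) /\
  forall g : galG L, \sum_(u <- s) u.1 * g u.2 = (g == 1%g)%:R.
Proof.
pose int_seq (s : seq (L * L)) := forall u, u \in s -> u.1 \in OL /\ u.2 \in OL.
pose F s (g : galG L) := \sum_(u <- s : seq (L * L)) u.1 * g u.2.
have sep g : g != 1%g -> exists s, [/\ int_seq s, F s 1%g = 1 & F s g = 0].
  move=> /inertia_trivial[x xO xP].
  have wO := unit_modpi (rpredB (gal_valring int_alpha g xO) xO) xP.
  have gxx : g x - x != 0 by apply: contraNneq xP => ->; rewrite rpred0.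
  exists [:: (g x / (g x - x), 1); (- (g x - x)^-1, x)]; split.
  - have gO := gal_valring int_alpha g xO.
    move=> u; rewrite !in_cons in_nil orbF => /orP[]/eqP-> /=.
      by rewrite rpred1 rpredM.
    by rewrite rpredN.
  - by rewrite /F big_cons big_seq1 /= !gal_id mulr1 mulNr mulrC -mulrBr mulVf.
  - by rewrite /F big_cons big_seq1 /= rmorph1 mulr1 mulNr mulrC subrr.
suff [s [sO s1 sg]] : exists s, [/\ int_seq s, F s 1%g = 1
    & forall g, g \in enum (galG L) -> g != 1%g -> F s g = 0].
  exists s; split=> // g; have [->|g1] := eqVneq g 1%g; first exact: s1.
  by apply: sg; rewrite ?mem_enum.
elim: (enum _) => [|g r [s [sO s1 sr]]].
  exists [:: (1, 1)]; split=> //.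
    by move=> u; rewrite mem_seq1 => /eqP->; rewrite /= rpred1.
  by rewrite /F big_seq1 /= gal_id mulr1.
have [->|/sep[t [tO t1 tg]]] := eqVneq g 1%g.
  exists s; split=> // h; rewrite inE => /orP[/eqP->|]; last exact: sr.
  by rewrite eqxx.
pose st := [seq (u.1 * w.1, u.2 * w.2) | u <- s, w <- t].
have FM h : F st h = F s h * F t h.
  rewrite /F /st big_allpairs_dep big_distrlr /=; apply: eq_bigr => u _.
  by apply: eq_bigr => w _; rewrite rmorphM mulrACA.
exists st; split.
- move=> _ /allpairsP[[u w] /= [/sO[u1 u2] /tO[w1 w2] ->]] /=.
  by rewrite !rpredM.
- by rewrite FM s1 t1 mulr1.
- move=> h; rewrite inE FM => /orP[/eqP->|hr h1]; first by rewrite tg mulr0.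
  by rewrite sr // mul0r.
Qed.

End Faithful.

(** * Passing to quotients *)

Section QuotientIso.
Variables (R R' : pzRingType) (O : {pred R}) (s : R -> R').
Variables (X Y : lmodType R) (X' Y' : lmodType R').
Variables (mulX : X -> X -> X) (mulY : Y -> Y -> Y).
Variables (mulX' : X' -> X' -> X') (mulY' : Y' -> Y' -> Y').
Variables (A A0 : set X) (B B0 : set Y) (C : set X') (D : set Y').
Variables (q : X -> X') (r : Y -> Y') (f : X -> Y) (f' : X' -> Y').

(** A five lemma for algebras: an isomorphism of the middle terms of two short
    exact sequences that carries one kernel onto the other induces an isomorphism
    of the quotients.  That the induced map is a homomorphism follows by lifting
    its arguments along [q]. *)
Lemma iso_on_quotient :
  (forall c', exists2 c, c \in O & s c = c') ->
  (forall x y, A x -> A y -> A (x - y)) ->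
  (forall c x, c \in O -> A x -> A (c *: x)) ->
  (forall x y, A x -> A y -> A (mulX x y)) ->
  hom_on mulX mulX' O s A q -> hom_on mulY mulY' O s B r ->
  short_exact A0 A C q -> short_exact B0 B D r ->
  iso_on mulX mulY O A B f -> set_bij A0 B0 f ->
  (forall x, A x -> f' (q x) = r (f x)) ->
  iso_on mulX' mulY' predT C D f'.
Proof.
move=> sO Asub AZ AM [qD qZ qM] [rD rZ rM] [_ A0E qAC] [_ B0E rBD].
move=> [[fD fZ fM] [fAB finj fsurj]] [_ _ fsurj0] comm.
have AD x y : A x -> A y -> A (x + y).
  move=> Ax Ay; have := Asub _ _ Ax (Asub _ _ (Asub _ _ Ay Ay) Ay).
  by rewrite subrr sub0r opprK.
have lift x' : C x' -> exists2 x, A x & q x = x' by rewrite -qAC.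
split; [split|split].
- move=> _ _ /lift[x Ax <-] /lift[y Ay <-].
  by rewrite -qD // !comm ?fD ?rD //; [apply: fAB|apply: fAB|apply: AD].
- move=> c' _ _ /lift[x Ax <-]; have [c cO <-] := sO c'.
  by rewrite -qZ // !comm ?fZ ?rZ //; [apply: fAB|apply: AZ].
- move=> _ _ /lift[x Ax <-] /lift[y Ay <-].
  by rewrite -qM // !comm ?fM ?rM //; [apply: fAB|apply: fAB|apply: AM].
- move=> _ /lift[x Ax <-]; rewrite comm // -rBD.
  by exists (f x) => //; apply: fAB.
- move=> x' y'; rewrite !inE => /lift[x Ax <-] /lift[y Ay <-].
  rewrite !comm // => rxy.
  have Axy := Asub x y Ax Ay.
  have qxy : q x = q (x - y) + q y by rewrite -qD ?subrK.
  have : r (f (x - y)) = 0.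
    by apply: (addIr (r (f y))); rewrite add0r -rD -?fD ?subrK //; apply: fAB.
  move=> rf0; have : B0 (f (x - y)) by rewrite B0E; split=> //; apply: fAB.
  move=> /fsurj0[z A0z fz]; have : A z by move: A0z; rewrite A0E => -[].
  move=> Az; have := finj _ _ (mem_set Az) (mem_set Axy) fz => zE.
  by move: A0z; rewrite A0E zE qxy => -[_ ->]; rewrite add0r.
- move=> y'; rewrite -rBD => -[y By <-].
  have [x Ax fx] := fsurj y By.
  by exists (q x); [rewrite -qAC; exists x|rewrite comm // fx].
Qed.

End QuotientIso.

Section MatrixOf.
Variables (R : pzRingType) (M : lmodType R) (n : nat) (b : 'I_n -> M).
Hypothesis b_basis : module_basis b.

Lemma matrix_of_eq (f : M -> M) (A : 'M[R]_n) :
  (forall j, f (b j) = \sum_(i < n) A i j *: b i) -> matrix_of b f = A.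
Proof.
move=> fA; rewrite /matrix_of; case: xgetP => [B _ fB|/(_ A)//].
apply/matrixP => i j; have [c [_ cU]] := b_basis (f (b j)).
have cE (B' : 'M[R]_n) : f (b j) = \sum_(l < n) B' l j *: b l ->
    c = [ffun l => B' l j].
  by move=> fB'; apply: cU; rewrite fB'; apply: eq_bigr => l _; rewrite ffunE.
by have := cE A (fA j); rewrite (cE B (fB j)) => /ffunP/(_ i); rewrite !ffunE.
Qed.

End MatrixOf.

(** * The maps [phi] and [psi] *)

Section LinearMaps.
Variables (K : fieldType) (L : splittingFieldType K).

(** [phi] is a [linfun], which can be evaluated only through a registered
    linearity proof of the underlying function. *)
Definition skew_act (a : {ffun galG L -> L}) (x : L) : L :=
  \sum_(g : galG L) a g * g x.

Lemma skew_act_linear a : linear (skew_act a).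
Proof.
move=> c x y; rewrite /skew_act scaler_sumr -big_split /=.
by apply: eq_bigr => g _; rewrite linearP mulrDr scalerAr.
Qed.

HB.instance Definition _ a := GRing.isLinear.Build K L L *:%R (skew_act a)
  (skew_act_linear a).

Lemma phiE a x : phi L a x = \sum_(g : galG L) a g * g x.
Proof. exact: (lfunE (skew_act a)). Qed.

Definition mx_act n (alpha : n.-tuple L) (M : 'M[K]_n) (x : L) : L :=
  \sum_j coord alpha j x *: \sum_i M i j *: tnth alpha i.

Lemma mx_act_linear n (alpha : n.-tuple L) M : linear (mx_act alpha M).
Proof.
move=> c x y; rewrite /mx_act scaler_sumr -big_split /=.
by apply: eq_bigr => j _; rewrite linearP scalerDl scalerA.
Qed.

HB.instance Definition _ n (alpha : n.-tuple L) M :=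
  GRing.isLinear.Build K L L *:%R (mx_act alpha M) (mx_act_linear alpha M).

Lemma phiD a b : phi L (a + b) = phi L a + phi L b.
Proof.
apply/lfunP => x; rewrite add_lfunE !phiE -big_split /=.
by apply: eq_bigr => g _; rewrite ffunE mulrDl.
Qed.

Lemma phiZ (c : K) a : phi L (c *: a) = c *: phi L a.
Proof.
apply/lfunP => x; rewrite scale_lfunE !phiE scaler_sumr.
by apply: eq_bigr => g _; rewrite ffunE scalerAl.
Qed.

Lemma phiM a b : phi L (skew_mulL L a b) = (phi L a \o phi L b)%VF.
Proof.
apply/lfunP => x; rewrite comp_lfunE !phiE.
transitivity (\sum_g \sum_(h : galG L) a g * g (b h) * (h * g)%g x).
  transitivity (\sum_c \sum_g \sum_(h | (h * g)%g == c) a g * g (b h) * c x).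
    apply: eq_bigr => c _; rewrite ffunE big_distrl /=.
    by apply: eq_bigr => g _; rewrite big_distrl.
  (* for given g and h only c = h * g contributes *)
  rewrite exchange_big /=; apply: eq_bigr => g _.
  rewrite (exchange_big_dep predT) //=; apply: eq_bigr => h _.
  by apply: big_pred1 => c; rewrite eq_sym.
apply: eq_bigr => g _; rewrite rmorph_sum mulr_sumr.
by apply: eq_bigr => h _; rewrite galM ?memvf // rmorphM mulrA.
Qed.

End LinearMaps.

Section Levels.
Variables (K : fieldType) (V : localField K) (L : splittingFieldType K).
Variable E : unramifiedGalois V L.
Local Notation p := (lf_pi V).
Local Notation P := ((lf_pi V)%:A : L).
Local Notation OL := (valring E).
Local Notation OK := (valring V).

Lemma gal_trace_scalar x : exists c : K, \sum_(g : galG L) g x = c%:A.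
Proof.
have /vlineP[c cE] := mem_galTrace (ug_galois E) (memvf x).
exists c; rewrite -cE /galTrace; apply: eq_bigl => g.
by rewrite gal_kHom ?sub1v // k1HomE ahomWin.
Qed.

Variables (n : nat) (alpha : n.-tuple L).
Hypothesis int_alpha : integral_basis E alpha.
Let gal_int := gal_valring int_alpha.

Section Coordinates.
Variable s : seq (L * L).
Hypothesis s_delta : forall g : galG L,
  \sum_(u <- s) u.1 * g u.2 = (g == 1%g)%:R.

(** The inverse of [phi] when [s] consists of Galois coordinates.  If these are
    integral, it visibly respects the filtrations by powers of [pi]. *)
Definition phi_inv (f : 'End(L)) : {ffun galG L -> L} :=
  [ffun h => \sum_(u <- s) (h : galG L) u.1 * f u.2].

Lemma coordinates_delta2 (g h : galG L) :
  \sum_(u <- s) h u.1 * g u.2 = (g == h)%:R.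
Proof.
have -> : (g == h)%:R = h ((g * h^-1)%g == 1%g)%:R.
  by rewrite -eq_mulgV1 rmorph_nat.
rewrite -s_delta rmorph_sum; apply: eq_bigr => u _.
by rewrite rmorphM /= -[g in LHS](mulgKV h) galM ?memvf.
Qed.

Lemma phiK a : phi_inv (phi L a) = a.
Proof.
apply/ffunP => h; rewrite ffunE.
transitivity (\sum_g a g * \sum_(u <- s) h u.1 * g u.2).
  under eq_bigr do rewrite phiE mulr_sumr.
  rewrite exchange_big; apply: eq_bigr => g _.
  by rewrite mulr_sumr; apply: eq_bigr => u _; rewrite mulrCA.
rewrite (bigD1 h) //= coordinates_delta2 eqxx mulr1 big1 ?addr0 // => g gh.
by rewrite coordinates_delta2 (negPf gh) mulr0.
Qed.

(** With [Tr] the trace from [L] to [K], [phi (phi_inv f) z] is the sum over [u]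
    of [Tr (u.1 * z) * f u.2].  The trace is a scalar, so it can be moved into
    [f], whose argument then is [z] by the orthogonality relations. *)
Lemma phi_invK f : phi L (phi_inv f) = f.
Proof.
apply/lfunP => z; rewrite phiE.
have [t tE] := choice (fun u : L * L => gal_trace_scalar (u.1 * z)).
transitivity (f (\sum_(u <- s) t u *: u.2)).
  rewrite linear_sum /=.
  under eq_bigr do rewrite ffunE big_distrl.
  rewrite exchange_big; apply: eq_bigr => u _.
  rewrite linearZ /= -mulr_algl -tE mulr_suml; apply: eq_bigr => g _.
  by rewrite rmorphM /= mulrAC.
congr (f _).
transitivity (\sum_(g : galG L) g z * \sum_(u <- s) g u.1 * (1%g : galG L) u.2).
  under [RHS]eq_bigr do rewrite mulr_sumr.
  rewrite exchange_big; apply: eq_bigr => u _.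
  rewrite -mulr_algl -tE mulr_suml; apply: eq_bigr => g _.
  by rewrite rmorphM /= gal_id -mulrA mulrCA.
rewrite (bigD1 1%g) //= coordinates_delta2 eqxx mulr1 gal_id big1 ?addr0 //.
by move=> g g1; rewrite coordinates_delta2 eq_sym (negPf g1) mulr0.
Qed.

End Coordinates.

Lemma piLX_scale j x : P ^+ j * x = p ^+ j *: x.
Proof. by rewrite -[RHS]mulr_algl -!in_algE rmorphXn. Qed.

(** An endomorphism commutes with [pi], a scalar; so divisibility by [pi ^+ k] on
    the integers propagates to the whole filtration. *)
Lemma EndIP k f : EndI E k f <-> forall j x,
  x \in maxpowL E j -> f x \in maxpowL E (k + j).
Proof.
split=> [fP j x|fP x xO]; last first.
  by rewrite -[k]addn0; apply: fP; rewrite [_ \in _]maxpow0.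
rewrite maxpowE => /fP fxP.
have -> : f x = f (x / P ^+ j) * P ^+ j.
  have xE : x = p ^+ j *: (x / P ^+ j).
    by rewrite -piLX_scale mulrC divfK // expf_neq0 // piL_neq0.
  by rewrite [in LHS]xE linearZ /= -piLX_scale mulrC.
apply: maxpowM fxP _.
by rewrite maxpowE divff ?rpred1 // expf_neq0 // piL_neq0.
Qed.

Lemma phi_bij k : set_bij (skewI E k) (EndI E k) (phi L).
Proof.
have [s [sO sd]] := galois_coordinates int_alpha.
split.
- move=> a aP x xO; rewrite phiE rpred_sum // => g _.
  by rewrite mulrC maxpowMl ?gal_int //; apply: aP.
- by move=> a b _ _ /(congr1 (phi_inv s)); rewrite !phiK.
- move=> f fP; exists (phi_inv s f); last exact: phi_invK.
  move=> g; rewrite ffunE big_seq rpred_sum // => u /sO[u1 u2].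
  by rewrite maxpowMl ?gal_int //; apply: fP.
Qed.

Lemma psi_coord (f : 'End(L)) j :
  f (tnth alpha j) = \sum_i psi alpha f i j *: tnth alpha i.
Proof.
rewrite {1}(coordK int_alpha (f _)).
by apply: eq_bigr => i _; rewrite mxE.
Qed.

Lemma lfun_coord (f : 'End(L)) x :
  f x = \sum_j coord alpha j x *: f (tnth alpha j).
Proof.
rewrite {1}(coordK int_alpha x) linear_sum /=.
by apply: eq_bigr => j _; rewrite linearZ.
Qed.

Lemma coord_alpha i j : coord alpha i (tnth alpha j) = (i == j)%:R.
Proof.
have -> : tnth alpha j = \sum_l (l == j)%:R *: tnth alpha l.
  rewrite (bigD1 j) //= eqxx scale1r big1 ?addr0 // => l /negPf->.
  by rewrite scale0r.
exact: (coord_comb int_alpha (fun l => (l == j)%:R)).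
Qed.

Lemma psi_bij k : set_bij (EndI E k) (MatI V n k) (psi alpha).
Proof.
split.
- move=> f fP i j; rewrite mxE; apply: (maxpowL_coord int_alpha k _).1.
  by apply: fP; apply: alpha_int.
- move=> f g _ _ fg; apply/lfunP => x.
  rewrite (lfun_coord f) (lfun_coord g).
  by apply: eq_bigr => j _; rewrite !psi_coord fg.
- move=> M MP; pose f : 'End(L) := linfun (mx_act alpha M).
  have fa j : f (tnth alpha j) = \sum_i M i j *: tnth alpha i.
    rewrite lfunE /= /mx_act (bigD1 j) //= coord_alpha eqxx scale1r.
    rewrite [X in _ + X]big1 ?addr0 // => l /negPf lj.
    by rewrite coord_alpha lj scale0r.
  exists f; last first.
    apply/matrixP => i j; rewrite mxE fa.
    exact: (coord_comb int_alpha (fun i => M i j)).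
  move=> x /(valring_coord int_alpha) xO.
  rewrite lfun_coord rpred_sum // => j _.
  apply: maxpowL_scale => //; rewrite fa; apply/(maxpowL_coord int_alpha) => i.
  by rewrite (coord_comb int_alpha (fun i => M i j)); apply: MP.
Qed.

Lemma psiM f g : psi alpha (f \o g)%VF = psi alpha f *m psi alpha g.
Proof.
apply/matrixP => i j; rewrite !mxE comp_lfunE (psi_coord g) !linear_sum /=.
by apply: eq_bigr => l _; rewrite !linearZ /= !mxE mulrC.
Qed.

Lemma psiD f g : psi alpha (f + g) = psi alpha f + psi alpha g.
Proof. by apply/matrixP => i j; rewrite !mxE add_lfunE linearD. Qed.

Lemma psiZ c f : psi alpha (c *: f) = c *: psi alpha f.
Proof. by apply/matrixP => i j; rewrite !mxE scale_lfunE linearZ. Qed.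

Lemma phi_iso k : iso_on (skew_mulL L) (fun f g : 'End(L) => (f \o g)%VF)
  OK (skewI E k) (EndI E k) (phi L).
Proof.
split; last exact: phi_bij.
by split=> *; [exact: phiD|exact: phiZ|exact: phiM].
Qed.

Lemma psi_iso k : iso_on (fun f g : 'End(L) => (f \o g)%VF) (@mulmx K n n n)
  OK (EndI E k) (MatI V n k) (psi alpha).
Proof.
split; last exact: psi_bij.
by split=> *; [exact: psiD|exact: psiZ|exact: psiM].
Qed.

(** ** Reduction modulo [pi ^+ k] *)

Section Reductions.
Variable k : nat.
Local Notation redL := (redL E k).

Lemma redL_surj z : exists2 x, x \in OL & redL x = z.
Proof. exact: red_surj. Qed.

Lemma redK_surj c' : exists2 c, c \in OK & redK V k c = c'.
Proof. exact: red_surj. Qed.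

(** [gal_res] and [End_red] are defined by applying a map to the chosen
    representative of a class; any other representative does as well when the map
    preserves both the integers and the ideal. *)
Lemma redL_repr (f : {additive L -> L}) x :
  (forall y, y \in OL -> f y \in OL) ->
  (forall y, y \in maxpowL E k -> f y \in maxpowL E k) ->
  x \in OL -> redL (f (val (repr (redL x)))) = redL (f x).
Proof.
move=> fO fP xO; set y := val _.
have yO : y \in OL := valP (repr (redL x)).
have yx : redL y = redL x by rewrite /y [LHS]red_val reprK.
apply/red_eq; rewrite ?fO // -raddfB; apply: fP.
by move: yx => /(red_eq _ _ yO xO).
Qed.

Lemma gal_res_red (g : galG L) x :
  x \in OL -> gal_res E k g (redL x) = redL (g x).
Proof.
move=> xO; apply: (@redL_repr g) => // y; first exact: gal_int.
exact: gal_maxpowL int_alpha g k y.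
Qed.

Lemma EndI0_int f x : EndI E 0 f -> x \in OL -> f x \in OL.
Proof. by move=> fP xO; rewrite -[_ \in _](maxpow0 E P); apply: fP. Qed.

Lemma End_red_red (f : 'End(L)) x : EndI E 0 f ->
  x \in OL -> End_red E k f (redL x) = redL (f x).
Proof.
move=> fP xO; apply: (@redL_repr f) => // y; first exact: EndI0_int.
by move/EndIP: fP => /(_ k y).
Qed.

Lemma redL_sum (I : finType) (Q : pred I) (F : I -> L) :
  (forall i, Q i -> F i \in OL) ->
  redL (\sum_(i | Q i) F i) = \sum_(i | Q i) redL (F i).
Proof. exact: red_sum. Qed.

Lemma redL_eq0 x : x \in OL -> redL x = 0 <-> x \in maxpowL E k.
Proof. exact: red_eq0. Qed.

Lemma maxpowL0 x : (x \in maxpowL E 0) = (x \in OL).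
Proof. exact: maxpow0. Qed.

Lemma maxpowL_int x : x \in maxpowL E k -> x \in OL.
Proof.
rewrite -maxpowL0; apply: maxpow_leq => //; first exact: piL_int.
exact: piL_neq0.
Qed.

Lemma maxpowK_int x : x \in maxpowK V k -> x \in OK.
Proof.
rewrite -(maxpow0 V p); apply: maxpow_leq => //; first exact: piK_int.
exact: lf_pi_neq0.
Qed.

Lemma basis_res_basis : module_basis (basis_res E k alpha).
Proof.
move=> z; have [x xO <-] := redL_surj z.
exists [ffun i => redK V k (coord alpha i x)]; split.
  rewrite (redL_coord int_alpha) //.
  by apply: eq_bigr => i _; rewrite ffunE.
move=> c xE; apply/ffunP => i; rewrite ffunE.
have [d dO dc] : exists2 d : 'I_n -> K,
    forall j, d j \in OK & forall j, redK V k (d j) = c j.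
  by exists (fun j => val (repr (c j))) => j; [exact: (valP (repr (c j)))
    |rewrite [LHS]red_val reprK].
have yO : \sum_i d i *: tnth alpha i \in OL.
  by rewrite rpred_sum // => j _; rewrite valringZ // (alpha_int int_alpha).
have : redL x = redL (\sum_i d i *: tnth alpha i).
  rewrite xE redL_sum => [|j _]; last first.
    by rewrite valringZ // (alpha_int int_alpha).
  apply: eq_bigr => j _.
  by rewrite redL_scale ?(alpha_int int_alpha) // dc.
move=> /(red_eq _ _ xO yO)/(maxpowL_coord int_alpha)/(_ i).
rewrite linearB /= (coord_comb int_alpha) -dc => /red_eq; apply=> //.
exact: (valring_coord int_alpha x).1.
Qed.

(** For a linear [F] the representative [repr z] can be expanded in the integral
    basis before reducing. *)
Lemma End_res_sum (F : resL E k -> resL E k) z : End_res E k F ->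
  F z = \sum_i redK V k (coord alpha i (val (repr z)))
                 *: F (basis_res E k alpha i).
Proof.
move=> Flin; pose F' : {linear resL E k -> resL E k} :=
  HB.pack F (GRing.isLinear.Build (resK V k) (resL E k) (resL E k) *:%R F Flin).
have zE : z = redL (val (repr z)) by rewrite [RHS]red_val reprK.
rewrite {1}zE (redL_coord int_alpha) ?(valP (repr z)) //.
rewrite -[F]/(F' : _ -> _) linear_sum; apply: eq_bigr => i _.
by rewrite linearZ.
Qed.

Lemma End_red_linear f : EndI E 0 f -> End_res E k (End_red E k f).
Proof.
move=> fP c z w; have [x xO <-] := redL_surj z; have [y yO <-] := redL_surj w.
have [a aO <-] := redK_surj c.
have fO u : u \in OL -> f u \in OL by apply: EndI0_int.
rewrite -redL_scale // -[X in End_red _ _ _ X]redD ?valringZ //.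
rewrite !End_red_red ?rpredD ?valringZ // linearD linearZ /=.
by rewrite [LHS]redD ?fO ?valringZ ?fO // [X in X + _]redL_scale ?fO.
Qed.

Lemma skew_red_hom : hom_on (skew_mulL L) (skew_mul_res E k)
  OK (redK V k) (skewI E 0) (skew_red E k).
Proof.
have int a g : skewI E 0 a -> a g \in OL by move=> aP; rewrite -maxpowL0.
split.
- move=> a b aP bP; apply/ffunP => g; rewrite !ffunE.
  by rewrite [LHS]redD ?int.
- by move=> c a cO aP; apply/ffunP => g; rewrite !ffunE redL_scale ?int.
- move=> a b aP bP; apply/ffunP => c.
  rewrite !ffunE redL_sum => [|g _]; last first.
    by rewrite rpred_sum // => h _; rewrite rpredM ?gal_int ?int.
  apply: eq_bigr => g _; rewrite redL_sum => [|h _]; last first.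
    by rewrite rpredM ?gal_int ?int.
  apply: eq_bigr => h _; rewrite [LHS]redM ?gal_int ?int // !ffunE.
  by rewrite gal_res_red ?int.
Qed.

Lemma End_red_hom : hom_on (fun f g : 'End(L) => (f \o g)%VF)
  (fun f g : resL E k -> resL E k => f \o g)
  OK (redK V k) (EndI E 0) (End_red E k).
Proof.
split.
- move=> f g fP gP; apply/funext => z; rewrite [RHS]/=.
  rewrite /End_red add_lfunE [LHS]redD //; apply: EndI0_int => //;
  exact: (valP (repr z)).
- move=> c f cO fP; apply/funext => z.
  rewrite /End_red scale_lfunE redL_scale //; apply: EndI0_int => //.
  exact: (valP (repr z)).
- move=> f g fP gP; apply/funext => z; rewrite [RHS]/=.
  have gO : g (val (repr z)) \in OL by apply: EndI0_int (valP (repr z)).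
  have -> : End_red E k g z = redL (g (val (repr z))) by [].
  rewrite End_red_red //.
  by rewrite /End_red comp_lfunE.
Qed.

Lemma Mat_red_hom : hom_on (@mulmx K n n n) (@mulmx (resK V k) n n n)
  OK (redK V k) (MatI V n 0) (Mat_red V k).
Proof.
have int (M : 'M[K]_n) i j : MatI V n 0 M -> M i j \in OK.
  by move=> MP; rewrite -(maxpow0 V p); apply: MP.
split.
- by move=> M N MP NP; apply/matrixP => i j; rewrite !mxE [LHS]redD ?int.
- by move=> c M cO MP; apply/matrixP => i j; rewrite !mxE [LHS]redM ?int.
- move=> M N MP NP; apply/matrixP => i j; rewrite !mxE [LHS]red_sum => [|l _].
    by apply: eq_bigr => l _; rewrite !mxE redM ?int.
  by rewrite rpredM ?int.
Qed.

Lemma skew_exact : short_exact (skewI E k) (skewI E 0) setT (skew_red E k).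
Proof.
split.
- by move=> a aP g; rewrite maxpowL0 maxpowL_int.
- apply/seteqP; split=> a.
    move=> aP; split=> [g|]; first by rewrite maxpowL0 maxpowL_int.
    apply/ffunP => g; rewrite !ffunE; apply/redL_eq0; last exact: aP.
    exact: maxpowL_int.
  move=> [aP /ffunP a0] g; have := a0 g; rewrite !ffunE => /redL_eq0; apply.
  by rewrite -maxpowL0.
- apply/seteqP; split=> // z _.
  exists [ffun g => val (repr (z g))].
    by move=> g; rewrite ffunE maxpowL0 (valP (repr (z g))).
  by apply/ffunP => g; rewrite !ffunE [LHS]red_val reprK.
Qed.

(** For surjectivity, lift the values of a residual endomorphism at the reduced
    basis; the matrix of the lifts is integral, hence by [psi_bij] comes from an
    endomorphism of the ring of integers. *)
Lemma End_exact :
  short_exact (EndI E k) (EndI E 0) (End_res E k) (End_red E k).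
Proof.
split.
- by move=> f fP x xO; rewrite maxpowL0 maxpowL_int //; apply: fP.
- apply/seteqP; split=> f.
    move=> fP; have f0 : EndI E 0 f.
      by move=> x xO; rewrite maxpowL0 maxpowL_int //; apply: fP.
    split=> //; apply/funext => z; have [x xO <-] := redL_surj z.
    rewrite End_red_red //; apply/redL_eq0; last exact: fP.
    exact: EndI0_int.
  move=> [fP f0] x xO; have := congr1 (fun F => F (redL x)) f0.
  rewrite /= End_red_red // => /redL_eq0; apply; exact: EndI0_int.
- apply/seteqP; split=> [_ [f fP <-]|F Flin]; first exact: End_red_linear.
  pose y j := val (repr (F (basis_res E k alpha j))).
  have yO j : y j \in OL by exact: (valP (repr _)).
  have [_ _ psi_surj] := psi_bij 0.
  have [|f fP fM] := psi_surj (\matrix_(i, j) coord alpha i (y j)).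
    move=> i j; rewrite mxE [_ \in _](maxpow0 V p).
    exact: (valring_coord int_alpha (y j)).1.
  exists f => //; apply/funext => z.
  rewrite (End_res_sum _ (End_red_linear fP)) (End_res_sum _ Flin).
  apply: eq_bigr => j _; congr (_ *: _).
  rewrite End_red_red ?(alpha_int int_alpha) // psi_coord fM.
  under eq_bigr do rewrite mxE.
  by rewrite -(coordK int_alpha) [LHS]red_val reprK.
Qed.

Lemma Mat_exact : short_exact (MatI V n k) (MatI V n 0) setT (Mat_red V k).
Proof.
split.
- by move=> M MP i j; rewrite [_ \in _](maxpow0 V p) maxpowK_int.
- apply/seteqP; split=> M.
    move=> MP; split=> [i j|].
      by rewrite [_ \in _](maxpow0 V p) maxpowK_int.
    apply/matrixP => i j; rewrite !mxE; apply/red_eq0; last exact: MP.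
    exact: maxpowK_int.
  move=> [MP /matrixP M0] i j; have := M0 i j; rewrite !mxE => /red_eq0; apply.
  by rewrite -(maxpow0 V p); apply: MP.
- apply/seteqP; split=> // Z _.
  exists (\matrix_(i, j) val (repr (Z i j))).
    by move=> i j; rewrite mxE [_ \in _](maxpow0 V p) (valP (repr (Z i j))).
  by apply/matrixP => i j; rewrite !mxE [LHS]red_val reprK.
Qed.

Lemma phi_comm a : skewI E 0 a ->
  phi_res E k (skew_red E k a) = End_red E k (phi L a).
Proof.
move=> aP; have aO g : a g \in OL by rewrite -maxpowL0.
have [fP _ _] := phi_bij 0.
apply/funext => z; have [x xO <-] := redL_surj z.
rewrite End_red_red ?phiE //; last exact: fP.
rewrite redL_sum => [|g _]; last by rewrite rpredM ?gal_int.
apply: eq_bigr => g _; rewrite ffunE gal_res_red //.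
by rewrite [RHS]redM ?gal_int.
Qed.

Lemma psi_comm f : EndI E 0 f ->
  psi_res E k alpha (End_red E k f) = Mat_red V k (psi alpha f).
Proof.
move=> fP; apply: matrix_of_eq; first exact: basis_res_basis.
move=> j; have aO := alpha_int int_alpha.
rewrite End_red_red // (redL_coord int_alpha) ?(EndI0_int fP) //.
by apply: eq_bigr => i _; rewrite !mxE.
Qed.

Lemma phi_res_iso :
  iso_on (skew_mul_res E k) (fun f g : resL E k -> resL E k => f \o g)
    predT setT (End_res E k) (phi_res E k).
Proof.
apply: (iso_on_quotient redK_surj _ _ _ skew_red_hom End_red_hom
  skew_exact End_exact (phi_iso 0) (phi_bij k) phi_comm).
- by move=> a b aP bP g; rewrite !ffunE rpredB ?aP ?bP.
- move=> c a cO aP g; rewrite ffunE; exact: maxpowL_scale (aP g).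
- move=> a b aP bP c; rewrite ffunE rpred_sum // => g _.
  rewrite rpred_sum // => h _.
  rewrite maxpowL0 rpredM ?gal_int // -maxpowL0; [exact: aP|exact: bP].
Qed.

Lemma psi_res_iso :
  iso_on (fun f g : resL E k -> resL E k => f \o g)
    (@mulmx (resK V k) n n n) predT (End_res E k) setT (psi_res E k alpha).
Proof.
apply: (iso_on_quotient redK_surj _ _ _ End_red_hom Mat_red_hom
  End_exact Mat_exact (psi_iso 0) (psi_bij k) psi_comm).
- by move=> f g fP gP x xO; rewrite add_lfunE opp_lfunE rpredB ?fP ?gP.
- by move=> c f cO fP x xO; rewrite scale_lfunE maxpowL_scale ?fP.
- by move=> f g fP gP x xO; rewrite comp_lfunE; apply: fP; apply: EndI0_int.
Qed.

End Reductions.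
End Levels.

(** * The diagram *)

(* The left-hand squares of the diagram consist of two inclusions and two
   restrictions of one and the same map (phi, resp. psi alpha), so they commute
   as soon as these restrictions are well defined, which [iso_on] asserts. *)
Theorem theorem2p9 (K : fieldType) (V : localField K)
    (L : splittingFieldType K) (E : unramifiedGalois V L)
    (k n : nat) (alpha : n.-tuple L) :
  \dim {:L} = n -> integral_basis E alpha ->
  (* well-definedness of the induced actions, endomorphisms and matrices *)
  ([/\ forall (g : galG L) (x : L) (j : nat),
         x \in maxpowL E j -> g x \in maxpowL E j,
       forall (g : galG L) (x : L),
         x \in valring E -> gal_res E k g (redL E k x) = redL E k (g x),
       forall (f : 'End(L)) (x : L), EndI E 0 f ->
         x \in valring E -> End_red E k f (redL E k x) = redL E k (f x)
     & module_basis (basis_res E k alpha)]) /\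
  (* (1), (2) and (3) *)
  [/\ skewI E k = [set a | skewI E 0 a /\ skew_red E k a = 0],
      EndI E k = [set f | EndI E 0 f /\ End_red E k f = 0]
    & psi alpha @` EndI E k = MatI V n k] /\
  (* (4): commutativity, the maps of the rows, exactness, vertical maps *)
  [/\ (forall a, skewI E 0 a ->
         phi_res E k (skew_red E k a) = End_red E k (phi L a)) /\
      (forall f, EndI E 0 f ->
         psi_res E k alpha (End_red E k f) = Mat_red V k (psi alpha f)),
      [/\ hom_on (skew_mulL L) (skew_mul_res E k)
            (valring V) (redK V k) (skewI E 0) (skew_red E k),
          hom_on (fun f g : 'End(L) => (f \o g)%VF)
            (fun f g : resL E k -> resL E k => f \o g)
            (valring V) (redK V k) (EndI E 0) (End_red E k)
        & hom_on (@mulmx K n n n) (@mulmx (resK V k) n n n)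
            (valring V) (redK V k) (MatI V n 0) (Mat_red V k)],
      [/\ short_exact (skewI E k) (skewI E 0) setT (skew_red E k),
          short_exact (EndI E k) (EndI E 0) (End_res E k) (End_red E k)
        & short_exact (MatI V n k) (MatI V n 0) setT (Mat_red V k)],
      [/\ iso_on (skew_mulL L) (fun f g : 'End(L) => (f \o g)%VF)
            (valring V) (skewI E k) (EndI E k) (phi L),
          iso_on (skew_mulL L) (fun f g : 'End(L) => (f \o g)%VF)
            (valring V) (skewI E 0) (EndI E 0) (phi L)
        & iso_on (skew_mul_res E k) (fun f g : resL E k -> resL E k => f \o g)
            predT setT (End_res E k) (phi_res E k)]
    & [/\ iso_on (fun f g : 'End(L) => (f \o g)%VF) (@mulmx K n n n)
            (valring V) (EndI E k) (MatI V n k) (psi alpha),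
          iso_on (fun f g : 'End(L) => (f \o g)%VF) (@mulmx K n n n)
            (valring V) (EndI E 0) (MatI V n 0) (psi alpha)
        & iso_on (fun f g : resL E k -> resL E k => f \o g)
            (@mulmx (resK V k) n n n)
            predT (End_res E k) setT (psi_res E k alpha)]].
Proof.
move=> _ int_alpha; split; [split|split].
- by move=> g x j; apply: (gal_maxpowL int_alpha).
- by move=> g x; apply: (gal_res_red int_alpha).
- by move=> f x; apply: End_red_red.
- exact: (basis_res_basis int_alpha).
- split; first by have [] := skew_exact E k.
    by have [] := End_exact int_alpha k.
  have [psi_fun _ psi_surj] := psi_bij int_alpha k.
  by apply/seteqP; split=> // _ [f fP <-]; apply: psi_fun.
- split.
  + by split=> x; [apply: (phi_comm int_alpha)|apply: (psi_comm int_alpha)].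
  + split; [exact: (skew_red_hom int_alpha)|exact: End_red_hom|].
    exact: Mat_red_hom.
  + by split; [apply: skew_exact|apply: (End_exact int_alpha)|apply: Mat_exact].
  + by split; [apply: (phi_iso int_alpha)|apply: (phi_iso int_alpha)|
      apply: (phi_res_iso int_alpha)].
  + by split; [apply: (psi_iso int_alpha)|apply: (psi_iso int_alpha)|
      apply: (psi_res_iso int_alpha)].
Qed.
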